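(* Let $S$ be a semigroup, let $P_1^{\Box}$ and $P_2^{\Box}$ be any two cubic Pythagorean fuzzy sets on $S$, and let $\omega$ be a complete congruence relation on $S$. Then $$\overline{App}(P_1^{\Box})\circ\overline{App}(P_2^{\Box})\subseteq\overline{App}(P_1^{\Box}\circ P_2^{\Box}).$$
   Context: Congruence: an equivalence relation $\omega$ on $S$ is a congruence relation if $(z_1,z_2)\in\omega$ implies $(z_1x,z_2x)\in\omega$ and $(xz_1,xz_2)\in\omega$ for all $x\in S$. $[z]_\omega$ denotes the class of $z$; one always has $[z_1]_\omega[z_2]_\omega\subseteq[z_1z_2]_\omega$, and $\omega$ is complete if $[z_1]_\omega[z_2]_\omega=[z_1z_2]_\omega$ for all $z_1,z_2\in S$. Intervals: closed subintervals $[a^-,a^+]$ of $[0,1]$ are ordered componentwise; infima $\bigwedge$ and suprema $\bigvee$ are taken componentwise. The supremum over an empty family is $0$ (resp. $[0,0]$), and the infimum over an empty family is $1$ (resp. $[1,1]$). A cubic Pythagorean fuzzy set (CPFS) on $S$ is $P^{\Box}=(\zeta_{p^\Box},\eta_{p^\Box})=\{\langle z,[\zeta_{\widetilde p}(z),\eta_{\widetilde p}(z)],(\zeta_p(z),\eta_p(z))\rangle : z\in S\}$, where $\zeta_{\widetilde p}(z)=[\zeta_p^-(z),\zeta_p^+(z)]$ and $\eta_{\widetilde p}(z)=[\eta_p^-(z),\eta_p^+(z)]$ are closed subintervals of $[0,1]$ with $(\zeta_p^+(z))^2+(\eta_p^+(z))^2\le 1$, and $\zeta_p(z),\eta_p(z)\in[0,1]$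 with $\zeta_p(z)^2+\eta_p(z)^2\le 1$. Here $\zeta_p,\eta_p$ are independent data. Write $\zeta_{p^\Box}=(\zeta_{\widetilde p},\zeta_p)$ and $\eta_{p^\Box}=(\eta_{\widetilde p},\eta_p)$; order, $\bigwedge$ and $\bigvee$ on such pairs are componentwise. Composition: $P_1^\Box\circ P_2^\Box=(\zeta_{p_1^\Box}\circ\zeta_{p_2^\Box},\ \eta_{p_1^\Box}\circ\eta_{p_2^\Box})$ with $(\zeta_{p_1^\Box}\circ\zeta_{p_2^\Box})(z)=\bigvee_{z=z_1z_2}[\zeta_{p_1^\Box}(z_1)\wedge\zeta_{p_2^\Box}(z_2)]$ and $(\eta_{p_1^\Box}\circ\eta_{p_2^\Box})(z)=\bigwedge_{z=z_1z_2}[\eta_{p_1^\Box}(z_1)\vee\eta_{p_2^\Box}(z_2)]$. The formulas are applied as they stand to any pair $(\zeta,\eta)$ of such functions. Inclusion: $(\zeta,\eta)\subseteq(\zeta',\eta')$ means $\zeta(z)\le\zeta'(z)$ and $\eta(z)\ge\eta'(z)$ for all $z\in S$, in both the interval and the number component. Upper approximation: $\overline{App}(P^\Box)=(\overline{\zeta_{p^\Box}},\overline{\eta_{p^\Box}})$ with $\overline{\zeta_{p^\Box}}(z)=\bigvee_{z'\in[z]_\omega}\zeta_{p^\Box}(z')$ and $\overline{\eta_{p^\Box}}(z)=\bigwedge_{z'\in[z]_\omega}\eta_{p^\Box}(z')$, componentwise for the interval and number parts. *)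

(* Defs.v *)
From mathcomp Require Import all_boot all_order all_algebra.
From mathcomp Require Import boolp classical_sets reals.
From mathcomp Require Import interval_inference.

Set Implicit Arguments.
Unset Strict Implicit.
Unset Printing Implicit Defensive.

Import Order.TTheory GRing.Theory Num.Theory.

Local Open Scope classical_set_scope.
Local Open Scope ring_scope.

Section UnitInterval.
Variable R : realType.
Implicit Types (A : set {i01 R}) (x : {i01 R}).

Definition vals A : set R := [set x%:num | x in A].

Lemma i01_ge0 x : 0 <= x%:num. Proof. by []. Qed.

Lemma i01_le1 x : x%:num <= 1. Proof. by []. Qed.

Lemma vals_has_ubound A : has_ubound (vals A).
Proof. by exists 1 => _ [x _ <-]; exact: i01_le1. Qed.

Lemma vals_has_lbound A : has_lbound (vals A).
Proof. by exists 0 => _ [x _ <-]; exact: i01_ge0. Qed.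

Lemma sup_vals_ge0 A : 0 <= sup (vals A).
Proof.
have [->|/set0P[_ [x xA _]]] := eqVneq (vals A) set0; first by rewrite sup0.
apply: le_trans (i01_ge0 x) _.
by apply: ub_le_sup; [exact: vals_has_ubound | exists x].
Qed.

Lemma sup_vals_le1 A : sup (vals A) <= 1.
Proof.
have [->|A0] := eqVneq (vals A) set0; first by rewrite sup0.
by apply: ge_sup; [exact/set0P | move=> _ [x _ <-]; exact: i01_le1].
Qed.

(* [sup set0 = 0] in the library, which is the bottom of [0, 1]. *)
Definition sup01 A : {i01 R} := Itv01 (sup_vals_ge0 A) (sup_vals_le1 A).

(* The library has [inf set0 = 0], hence the explicit case giving 1. *)
Definition inf_vals A : R := if `[< A = set0 >] then 1 else inf (vals A).

Lemma inf_vals_ge0 A : 0 <= inf_vals A.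
Proof.
rewrite /inf_vals; case: asboolP => // /eqP/set0P[x xA].
apply: lb_le_inf; first by exists x%:num; exists x.
by move=> _ [y _ <-]; exact: i01_ge0.
Qed.

Lemma inf_vals_le1 A : inf_vals A <= 1.
Proof.
rewrite /inf_vals; case: asboolP => // /eqP/set0P[x xA].
apply: le_trans (i01_le1 x).
by apply: ge_inf; [exact: vals_has_lbound | exists x].
Qed.

Definition inf01 A : {i01 R} := Itv01 (inf_vals_ge0 A) (inf_vals_le1 A).

Lemma sup01_ub A x : A x -> x <= sup01 A.
Proof.
by move=> xA; apply: (ub_le_sup (vals_has_ubound A)); exists x.
Qed.

Lemma sup01_least A x : (forall y, A y -> y <= x) -> sup01 A <= x.
Proof.
move=> Ax; change (sup (vals A) <= x%:num).
have [->|A0] := eqVneq (vals A) set0; first by rewrite sup0 i01_ge0.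
by apply: ge_sup; [exact/set0P | move=> _ [y yA <-]; exact: Ax].
Qed.

Lemma inf01_lb A x : A x -> inf01 A <= x.
Proof.
move=> xA; change (inf_vals A <= x%:num).
rewrite /inf_vals; case: asboolP => [A0|_]; first by move: xA; rewrite A0.
by apply: (ge_inf (vals_has_lbound A)); exists x.
Qed.

Lemma inf01_greatest A x : (forall y, A y -> x <= y) -> x <= inf01 A.
Proof.
move=> xA; change (x%:num <= inf_vals A).
rewrite /inf_vals; case: asboolP => [_|/eqP/set0P[y yA]]; first exact: i01_le1.
apply: lb_le_inf; first by exists y%:num; exists y.
by move=> _ [z zA <-]; exact: xA.
Qed.

End UnitInterval.

Section Subintervals.
Variable R : realType.

Record subitv := Subitv {
  lo : {i01 R};
  hi : {i01 R};
  lo_le_hi : lo <= hi }.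

Implicit Types (a b : subitv) (A : set subitv).

Definition itv_le a b : Prop := lo a <= lo b /\ hi a <= hi b.

Lemma itv_min_subproof a b :
  Order.min (lo a) (lo b) <= Order.min (hi a) (hi b).
Proof. by rewrite le_min !ge_min !lo_le_hi orbT. Qed.

Definition itv_min a b : subitv := Subitv (itv_min_subproof a b).

Lemma itv_max_subproof a b :
  Order.max (lo a) (lo b) <= Order.max (hi a) (hi b).
Proof. by rewrite ge_max !le_max !lo_le_hi orbT. Qed.

Definition itv_max a b : subitv := Subitv (itv_max_subproof a b).

Lemma itv_sup_subproof A :
  sup01 [set lo a | a in A] <= sup01 [set hi a | a in A].
Proof.
apply: sup01_least => _ [a aA <-]; apply: le_trans (lo_le_hi a) _.
by apply: sup01_ub; exists a.
Qed.

Definition itv_sup A : subitv := Subitv (itv_sup_subproof A).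

Lemma itv_inf_subproof A :
  inf01 [set lo a | a in A] <= inf01 [set hi a | a in A].
Proof.
apply: inf01_greatest => _ [a aA <-]; apply: le_trans (lo_le_hi a).
by apply: inf01_lb; exists a.
Qed.

Definition itv_inf A : subitv := Subitv (itv_inf_subproof A).

End Subintervals.

Section Cubic.
Variable R : realType.

Definition cubic : Type := (subitv R * {i01 R})%type.

Implicit Types (c d : cubic) (A : set cubic).

Definition cubic_le c d : Prop := itv_le c.1 d.1 /\ c.2 <= d.2.

Definition cubic_min c d : cubic := (itv_min c.1 d.1, Order.min c.2 d.2).

Definition cubic_max c d : cubic := (itv_max c.1 d.1, Order.max c.2 d.2).

Definition cubic_sup A : cubic :=
  (itv_sup [set c.1 | c in A], sup01 [set c.2 | c in A]).

Definition cubic_inf A : cubic :=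
  (itv_inf [set c.1 | c in A], inf01 [set c.2 | c in A]).

End Cubic.

(* Arbitrary pairs (zeta, eta), without the Pythagorean constraint: composition,
   inclusion and upper approximation are defined at this level. *)
Record cubic_pair (R : realType) (S : Type) := CubicPair {
  zeta : S -> cubic R;
  eta : S -> cubic R }.

Record cpfs (R : realType) (S : Type) := CPFS {
  cpfs_pair :> cubic_pair R S;
  cpfs_itv : forall z : S,
    (hi (zeta cpfs_pair z).1)%:num ^+ 2
      + (hi (eta cpfs_pair z).1)%:num ^+ 2 <= 1 :> R;
  cpfs_num : forall z : S,
    (zeta cpfs_pair z).2%:num ^+ 2 + (eta cpfs_pair z).2%:num ^+ 2 <= 1 :> R }.

Definition subcubic (R : realType) (S : Type) (P Q : cubic_pair R S) : Prop :=
  forall z : S,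
    cubic_le (zeta P z) (zeta Q z) /\ cubic_le (eta Q z) (eta P z).

Section Rough.
Variables (R : realType) (S : semigroupType).
Implicit Types (P Q : cubic_pair R S) (omega : S -> S -> Prop).

Definition factorizations (z : S) : set (S * S) :=
  [set p | z = (p.1 * p.2)%g].

Definition comp_cubic P Q : cubic_pair R S := {|
  zeta := fun z => cubic_sup
    [set cubic_min (zeta P p.1) (zeta Q p.2) | p in factorizations z];
  eta := fun z => cubic_inf
    [set cubic_max (eta P p.1) (eta Q p.2) | p in factorizations z] |}.

Definition congruence omega : Prop :=
  RelationClasses.Equivalence omega /\
  (forall z1 z2 x : S, omega z1 z2 ->
     omega (z1 * x)%g (z2 * x)%g /\ omega (x * z1)%g (x * z2)%g).

Definition cclass omega (z : S) : set S := [set z' | omega z z'].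

Definition complete_congruence omega : Prop :=
  congruence omega /\
  forall z1 z2 : S,
    [set (a * b)%g | a in cclass omega z1 & b in cclass omega z2]
      = cclass omega (z1 * z2)%g.

Definition upper_app omega P : cubic_pair R S := {|
  zeta := fun z => cubic_sup [set zeta P z' | z' in cclass omega z];
  eta := fun z => cubic_inf [set eta P z' | z' in cclass omega z] |}.

End Rough.

(* Main.v *)
Require Import Defs.
From mathcomp Require Import all_boot all_order all_algebra.
From mathcomp Require Import boolp classical_sets reals.
From mathcomp Require Import interval_inference.

(** Since [0, 1] is a chain, binary minima distribute over arbitrary suprema
    and binary maxima over arbitrary infima, and this passes componentwise to
    cubic values.  A factorization [z = z1 * z2] with [a] in the class of [z1]
    and [b] in the class of [z2] puts [a * b] in the class of [z], so each term
    [P1 a /\ P2 b] of the left-hand supremum is bounded by a term of the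
    right-hand one. *)

Set Implicit Arguments.
Unset Strict Implicit.
Unset Printing Implicit Defensive.

Import Order.TTheory.

Local Open Scope classical_set_scope.
Local Open Scope ring_scope.

Section UnitInterval.
Variable R : realType.
Implicit Types (A B : set {i01 R}) (x : {i01 R}).

(** Totality of the order gives a dichotomy: either [x] bounds [A], or some [a] in [A] exceeds [x],
    and then [min a b <= x] forces [b <= x] for every [b] in [B]. An empty [A] falls under the first
    case. *)
Lemma min_sup01_le A B x :
  (forall a b, A a -> B b -> Order.min a b <= x) ->
  Order.min (sup01 A) (sup01 B) <= x.
Proof.
move=> ABx; rewrite ge_min; apply/orP.
have [|/existsNP[a /not_implyP[Aa /negP]]] :=
  pselect (forall a, A a -> a <= x).
  by move=> Ax; left; exact: sup01_least.
rewrite -ltNge => xa; right; apply: sup01_least => b Bb.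
by have := ABx a b Aa Bb; rewrite ge_min leNgt xa.
Qed.

(** The dual dichotomy: an [a] in [A] strictly below [x] forces [x <= b] for every [b] in [B]. *)
Lemma le_max_inf01 A B x :
  (forall a b, A a -> B b -> x <= Order.max a b) ->
  x <= Order.max (inf01 A) (inf01 B).
Proof.
move=> ABx; rewrite le_max; apply/orP.
have [|/existsNP[a /not_implyP[Aa /negP]]] :=
  pselect (forall a, A a -> x <= a).
  by move=> Ax; left; exact: inf01_greatest.
rewrite -ltNge => ax; right; apply: inf01_greatest => b Bb.
by have := ABx a b Aa Bb; rewrite le_max leNgt ax.
Qed.

End UnitInterval.

Section Cubic.
Variable R : realType.
Implicit Types (c d : cubic R) (A B : set (cubic R)).

Lemma cubic_le_trans d c e : cubic_le c d -> cubic_le d e -> cubic_le c e.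
Proof.
case=> [[l1 h1] n1] [[l2 h2] n2].
by split; [split|]; [exact: le_trans l2|exact: le_trans h2|exact: le_trans n2].
Qed.

Lemma cubic_sup_ub A c : A c -> cubic_le c (cubic_sup A).
Proof.
move=> Ac; split; first split; apply: sup01_ub; last by exists c.
- by exists c.1 => //; exists c.
- by exists c.1 => //; exists c.
Qed.

Lemma cubic_inf_lb A c : A c -> cubic_le (cubic_inf A) c.
Proof.
move=> Ac; split; first split; apply: inf01_lb; last by exists c.
- by exists c.1 => //; exists c.
- by exists c.1 => //; exists c.
Qed.

Lemma cubic_sup_least A d :
  (forall c, A c -> cubic_le c d) -> cubic_le (cubic_sup A) d.
Proof.
move=> Ad; split; first split; apply: sup01_least.
- by move=> _ [_ [c /Ad[[? ?] _] <-] <-].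
- by move=> _ [_ [c /Ad[[? ?] _] <-] <-].
- by move=> _ [c /Ad[_ ?] <-].
Qed.

Lemma cubic_inf_greatest A d :
  (forall c, A c -> cubic_le d c) -> cubic_le d (cubic_inf A).
Proof.
move=> Ad; split; first split; apply: inf01_greatest.
- by move=> _ [_ [c /Ad[[? ?] _] <-] <-].
- by move=> _ [_ [c /Ad[[? ?] _] <-] <-].
- by move=> _ [c /Ad[_ ?] <-].
Qed.

(** [cubic_le] is only a partial order, so the dichotomy is run separately on the lower endpoint,
    the upper endpoint and the number; different coordinates may fall into different cases. *)
Lemma cubic_min_sup_le A B d :
  (forall a b, A a -> B b -> cubic_le (cubic_min a b) d) ->
  cubic_le (cubic_min (cubic_sup A) (cubic_sup B)) d.
Proof.
move=> ABd; split; first split; apply: min_sup01_le.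
- by move=> _ _ [_ [a Aa <-] <-] [_ [b Bb <-] <-]; have [[]] := ABd a b Aa Bb.
- by move=> _ _ [_ [a Aa <-] <-] [_ [b Bb <-] <-]; have [[]] := ABd a b Aa Bb.
- by move=> _ _ [a Aa <-] [b Bb <-]; have [] := ABd a b Aa Bb.
Qed.

Lemma cubic_le_max_inf A B d :
  (forall a b, A a -> B b -> cubic_le d (cubic_max a b)) ->
  cubic_le d (cubic_max (cubic_inf A) (cubic_inf B)).
Proof.
move=> ABd; split; first split; apply: le_max_inf01.
- by move=> _ _ [_ [a Aa <-] <-] [_ [b Bb <-] <-]; have [[]] := ABd a b Aa Bb.
- by move=> _ _ [_ [a Aa <-] <-] [_ [b Bb <-] <-]; have [[]] := ABd a b Aa Bb.
- by move=> _ _ [a Aa <-] [b Bb <-]; have [] := ABd a b Aa Bb.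
Qed.

End Cubic.

(** One factor is replaced at a time, passing through [a * z2]. *)
Lemma cclassM (S : semigroupType) (omega : S -> S -> Prop) (z1 z2 a b : S) :
  congruence omega -> cclass omega z1 a -> cclass omega z2 b ->
  cclass omega (z1 * z2)%g (a * b)%g.
Proof.
move=> [[_ _ trans] compat] z1a z2b; apply: (trans _ (a * z2)%g).
- exact: (compat _ _ _ z1a).1.
- exact: (compat _ _ _ z2b).2.
Qed.

Theorem theorem3p2 (R : realType) (S : semigroupType) (P1 P2 : cpfs R S)
    (omega : S -> S -> Prop) (homega : complete_congruence omega) :
  subcubic
    (comp_cubic (upper_app omega P1) (upper_app omega P2))
    (upper_app omega (comp_cubic P1 P2)).
Proof.
have [cong _] := homega; move=> z; split.
- apply: cubic_sup_least => _ [[z1 z2] /= zE <-].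
  apply: cubic_min_sup_le => _ _ [a z1a <-] [b z2b <-].
  (* The composite at [a * b] lies in between: [(a, b)] is one of the factorizations it ranges over,
     and it is itself one of the values ranged over by the upper approximation at [z]. *)
  apply: (@cubic_le_trans _ (zeta (comp_cubic P1 P2) (a * b)%g)).
  + by apply: cubic_sup_ub; exists (a, b).
  + apply: cubic_sup_ub; exists (a * b)%g => //.
    by rewrite zE; exact: cclassM.
(* Inclusion reverses the order on [eta], so the same two bounds are chained in the opposite
   order. *)
- apply: cubic_inf_greatest => _ [[z1 z2] /= zE <-].
  apply: cubic_le_max_inf => _ _ [a z1a <-] [b z2b <-].
  apply: (@cubic_le_trans _ (eta (comp_cubic P1 P2) (a * b)%g)).
  + apply: cubic_inf_lb; exists (a * b)%g => //.
    by rewrite zE; exact: cclassM.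
  + by apply: cubic_inf_lb; exists (a, b).
Qed.
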